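(* Let $\langle A_1,\prec_1\rangle$ and $\langle A_2,\prec_2\rangle$ be S4-subordination algebras with dual spaces $\langle X_1,\tau_1,\tau_{S_1}\rangle$ and $\langle X_2,\tau_2,\tau_{S_2}\rangle$. Let $h:A_1\to A_2$ be a meet-homomorphism with dual Boolean relation $R\subseteq X_2\times X_1$. Then the following conditions are equivalent: (1) $h$ satisfies the conditions (CO), (QH) and (DH); (2) $R(x)\neq\emptyset$ for all $x\in X_2$, and for all $U\in\mathrm{Clop}(X_1)$ both $g_R(\mathrm{int}_{S_1}(U))\subseteq\mathrm{int}_{S_2}(h_R(U))$ and $\mathrm{int}_{S_2}(h_R(U))\subseteq h_R(\mathrm{int}_{S_1}(U))$.
   Context: A subordination on a Boolean algebra $A$ is a binary relation $\prec$ on $A$ such that: (S1) $0\prec 0$ and $1\prec 1$; (S2) $a\prec b$ and $a\prec c$ imply $a\prec b\wedge c$; (S3) $a\prec c$ and $b\prec c$ imply $a\vee b\prec c$; (S4) $a\leq b\prec c\leq d$ implies $a\prec d$. The pair $\langle A,\prec\rangle$ is an S4-subordination algebra if moreover (S5) $a\prec b$ implies $a\leq b$, and (S6) $a\prec b$ implies that there is $c\in A$ with $a\prec c\prec b$. The dual space $\langle X,\tau,\tau_S\rangle$ of an S4-subordination algebra $\langle A,\prec\rangle$ is: $X=\mathrm{Ul}(A)$, the set of ultrafilters of $A$; $\tau$ is the Stone topology with base $\{\varphi(a):a\in A\}$, $\varphi(a)=\{x\in X:a\in x\}$; $\tau_S$ is the topology with base the sets $\{x\in X:x\cap{\downarrow}a\neq\emptyset\}$,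 $a\in A$, where ${\downarrow}a=\{b\in A:b\prec a\}$. $\mathrm{Clop}(X)$ is the set of clopen subsets of $\langle X,\tau\rangle$; $\mathrm{int}_S$ denotes interior with respect to $\tau_S$. A meet-homomorphism $h:A_1\to A_2$ is a map with $h(1)=1$ and $h(a\wedge b)=h(a)\wedge h(b)$; put $g(a)=\neg h(\neg a)$ for $a\in A_1$. Its dual Boolean relation is $R=\{(x,y)\in X_2\times X_1:h^{-1}(x)\subseteq y\}$; $R(x)=\{y\in X_1:(x,y)\in R\}$. For $Y\subseteq X_1$, $h_R(Y)=\{x\in X_2:R(x)\subseteq Y\}$ and $g_R(Y)=\{x\in X_2:R(x)\cap Y\neq\emptyset\}$. Conditions: (CO) $h(0)=0$; (QH) for $a\in A_2$, $b\in A_1$, if $a\prec_2 h(b)$ then there exists $c\in A_1$ such that $a\leq h(c)$ and $c\prec_1 b$; (DH) for all $a,b\in A_1$, if $a\prec_1 b$ then $g(a)\prec_2 h(b)$. *)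

(* Defs.v *)
From HB Require Import structures.
From mathcomp Require Import all_boot all_order.
From mathcomp Require Import boolp classical_sets topology.

Set Implicit Arguments.
Unset Strict Implicit.
Unset Printing Implicit Defensive.

Import Order.TTheory.
Local Open Scope classical_set_scope.

(* A Boolean algebra is a [ctbDistrLatticeType]; it may be trivial (0 = 1),
   in which case its dual space is empty. *)

Record is_subordination d (A : ctbDistrLatticeType d)
    (prec : A -> A -> Prop) : Prop := IsSubordination {
  sub_bot : prec \bot%O \bot%O ;
  sub_top : prec \top%O \top%O ;
  sub_meet : forall a b c, prec a b -> prec a c -> prec a (b `&` c)%O ;
  sub_join : forall a b c, prec a c -> prec b c -> prec (a `|` b)%O c ;
  sub_le : forall a b c e,
    (a <= b)%O -> prec b c -> (c <= e)%O -> prec a e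
}.

Record is_S4_subordination d (A : ctbDistrLatticeType d)
    (prec : A -> A -> Prop) : Prop := IsS4Subordination {
  S4_sub : is_subordination prec ;
  S4_refl : forall a b, prec a b -> (a <= b)%O ;
  S4_trans : forall a b, prec a b -> exists c, prec a c /\ prec c b
}.

(* Bundled with its axioms, because these are needed to build the topology
   tau_S below. *)
Record S4_subordination d (A : ctbDistrLatticeType d) := S4Subordination {
  prec_of :> A -> A -> Prop ;
  prec_ofP : is_S4_subordination prec_of
}.

Record proper_filter d (A : ctbDistrLatticeType d) (F : set A) : Prop :=
  ProperFilterOf {
  pf_top : F \top%O ;
  pf_meet : forall a b, F a -> F b -> F (a `&` b)%O ;
  pf_up : forall a b, (a <= b)%O -> F a -> F b ;
  pf_bot : ~ F \bot%O
}.

Definition is_ultrafilter d (A : ctbDistrLatticeType d) (F : set A) : Prop :=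
  proper_filter F /\ forall G : set A, proper_filter G -> F `<=` G -> G = F.

Record Ul d (A : ctbDistrLatticeType d) := MkUl {
  ul_set :> set A ;
  ul_setP : is_ultrafilter ul_set
}.

HB.instance Definition _ d (A : ctbDistrLatticeType d) :=
  gen_eqMixin (Ul A).
HB.instance Definition _ d (A : ctbDistrLatticeType d) :=
  gen_choiceMixin (Ul A).

Definition phi d (A : ctbDistrLatticeType d) (a : A) : set (Ul A) :=
  [set x : Ul A | (x : set A) a].

Section StoneBase.
Context d (A : ctbDistrLatticeType d).

Let phi_cover : \bigcup_(B in range (@phi d A)) id B = setT.
Proof.
rewrite predeqE => x; split=> // _.
by exists (phi \top%O); [exists \top%O | exact: (pf_top (ul_setP x).1)].
Qed.

Let phi_join (B C : set (Ul A)) (x : Ul A) :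
  range (@phi d A) B -> range (@phi d A) C -> id B x -> id C x ->
  exists E : set (Ul A),
    [/\ range (@phi d A) E, id E x & id E `<=` id B `&` id C].
Proof.
move=> [a _ <-] [b _ <-] xa xb; exists (phi (a `&` b)%O); split.
- by exists (a `&` b)%O.
- exact: (pf_meet (ul_setP x).1).
- move=> y yab; split; apply: (pf_up (ul_setP y).1) yab.
  + exact: leIl.
  + exact: leIr.
Qed.

(* [Ul A] itself carries the Stone topology tau. *)
HB.instance Definition _ :=
  isBaseTopological.Build (Ul A) phi_cover phi_join.

End StoneBase.

(* The same points as [Ul A]; this alias carries the topology tau_S. *)
Definition UlS d (A : ctbDistrLatticeType d) (prec : S4_subordination A)
  : Type := Ul A.

Definition down d (A : ctbDistrLatticeType d) (prec : A -> A -> Prop) (a : A)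
  : set A := [set b | prec b a].

Definition baseS d (A : ctbDistrLatticeType d) (prec : S4_subordination A)
    (a : A) : set (UlS prec) :=
  [set x : Ul A | (x : set A) `&` down prec a !=set0].

Section SBase.
Context d (A : ctbDistrLatticeType d) (prec : S4_subordination A).

HB.instance Definition _ := gen_eqMixin (UlS prec).
HB.instance Definition _ := gen_choiceMixin (UlS prec).

Let baseS_cover : \bigcup_(B in range (@baseS d A prec)) id B = setT.
Proof.
rewrite predeqE => x; split=> // _.
exists (baseS \top%O); first by exists \top%O.
exists \top%O; split; first exact: (pf_top (ul_setP x).1).
exact: (sub_top (S4_sub (prec_ofP prec))).
Qed.

Let baseS_join (B C : set (UlS prec)) (x : UlS prec) :
  range (@baseS d A prec) B -> range (@baseS d A prec) C ->
  id B x -> id C x ->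
  exists E : set (UlS prec),
    [/\ range (@baseS d A prec) E, id E x & id E `<=` id B `&` id C].
Proof.
have sP := S4_sub (prec_ofP prec).
move=> [a _ <-] [b _ <-] [a' [xa' pa]] [b' [xb' pb]].
exists (baseS (a `&` b)%O); split.
- by exists (a `&` b)%O.
- exists (a' `&` b')%O; split; first exact: (pf_meet (ul_setP x).1).
  apply: (sub_meet sP).
  + exact: (sub_le sP (leIl a' b') pa (lexx a)).
  + exact: (sub_le sP (leIr b' a') pb (lexx b)).
- move=> y [c [yc pc]]; split; exists c; split=> //.
  + exact: (sub_le sP (lexx c) pc (leIl a b)).
  + exact: (sub_le sP (lexx c) pc (leIr b a)).
Qed.

HB.instance Definition _ :=
  isBaseTopological.Build (UlS prec) baseS_cover baseS_join.

End SBase.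

Definition intS d (A : ctbDistrLatticeType d) (prec : S4_subordination A)
    (U : set (Ul A)) : set (Ul A) := @interior (UlS prec) U.

Section MeetHom.
Context d1 d2 (A1 : ctbDistrLatticeType d1) (A2 : ctbDistrLatticeType d2).

Definition is_meet_hom (h : A1 -> A2) : Prop :=
  h \top%O = \top%O /\ forall a b, h (a `&` b)%O = (h a `&` h b)%O.

Definition g_of (h : A1 -> A2) (a : A1) : A2 := (~` h (~` a))%O.

(* Relations are curried, so that [R x] is the set R(x). *)
Definition dual_rel (h : A1 -> A2) : Ul A2 -> set (Ul A1) :=
  fun x => [set y : Ul A1 | h @^-1` (x : set A2) `<=` (y : set A1)].

Definition h_rel (R : Ul A2 -> set (Ul A1)) (Y : set (Ul A1)) : set (Ul A2) :=
  [set x | R x `<=` Y].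

Definition g_rel (R : Ul A2 -> set (Ul A1)) (Y : set (Ul A1)) : set (Ul A2) :=
  [set x | R x `&` Y !=set0].

Definition cond_CO (h : A1 -> A2) : Prop := h \bot%O = \bot%O.

Definition cond_QH (prec1 : A1 -> A1 -> Prop) (prec2 : A2 -> A2 -> Prop)
    (h : A1 -> A2) : Prop :=
  forall (a : A2) (b : A1), prec2 a (h b) ->
    exists c : A1, (a <= h c)%O /\ prec1 c b.

Definition cond_DH (prec1 : A1 -> A1 -> Prop) (prec2 : A2 -> A2 -> Prop)
    (h : A1 -> A2) : Prop :=
  forall a b : A1, prec1 a b -> prec2 (g_of h a) (h b).

End MeetHom.

(* Main.v *)
Require Import Defs.
From mathcomp Require Import all_boot all_order.
From mathcomp Require Import boolp classical_sets topology.

(** The equivalence splits condition by condition once everything is computed on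
    the basic sets [phi b]. By compactness of the Stone space every clopen set is
    some [phi b] ([clopen_phi]), its [intS]-interior is [baseS prec b]
    ([intS_phi]), and the relation dual to [h] satisfies
    [h_rel R (phi b) = phi (h b)] and [g_rel R (phi a) = phi (g_of h a)]
    ([h_rel_phi], [g_rel_phi]). The two inclusions at the clopen set [phi b] then
    read: [g_rel R (baseS prec1 b)] is contained in [baseS prec2 (h b)], and
    [baseS prec2 (h b)] is contained in [h_rel R (baseS prec1 b)]. The first, for
    all [b], is (DH), the second is (QH), and nonemptiness of all the [R x] is
    (CO).

    From the algebra to the spaces, each of these is a matter of following the
    witnesses of a subordination through an ultrafilter. The way back needs
    enough ultrafilters; like the facts about basic sets, it rests on the prime
    ideal theorem, that a filter and an ideal with no common element are separated by
    an ultrafilter ([ultrafilter_separation]). It is used in two forms: applied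
    to the filter [h @^-1` x] it produces points of [R x] that avoid a given
    ideal ([dual_rel_avoid]); applied to a principal filter it turns a pointwise
    inclusion into membership in an ideal ([ideal_cover]), such as the ideal of
    the elements that precede a given one. *)

Local Open Scope classical_set_scope.

Set Implicit Arguments.
Unset Strict Implicit.
Unset Printing Implicit Defensive.
Import Order.Theory.
#[local] Arguments baseS {d A} prec a.

(** * Filters, ideals and ultrafilters *)

Section Separation.
Context d (A : ctbDistrLatticeType d).
Implicit Types (a b c : A) (F I : set A) (x y : Ul A).

Definition is_filter F : Prop :=
  [/\ F \top%O, (forall a b, F a -> F b -> F (a `&` b)%O)
    & (forall a b, (a <= b)%O -> F a -> F b)].

Definition is_ideal I : Prop :=
  [/\ I \bot%O, (forall a b, I a -> I b -> I (a `|` b)%O)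
    & (forall a b, (a <= b)%O -> I b -> I a)].

(** For a filter [F] and an ideal [I], the filter generated by [F] and the
    complements of the elements of [I]. *)
Definition filter_mod F I : set A :=
  [set a | exists f i, [/\ F f, I i & (f <= a `|` i)%O]].

Lemma ul_filter x : is_filter x.
Proof. by have [[? ? ? _] _] := ul_setP x. Qed.

Lemma ul_up x a b : (a <= b)%O -> (x : set A) a -> (x : set A) b.
Proof. exact: (pf_up (ul_setP x).1). Qed.

Lemma principal_ideal a : is_ideal [set b | (b <= a)%O].
Proof.
split=> /= [|b c ba ca|b c bc ca]; first exact: le0x.
- by rewrite leUx ba ca.
- exact: le_trans ca.
Qed.

Lemma sub_filter_mod F I : is_ideal I -> F `<=` filter_mod F I.
Proof. by move=> [I0 _ _] a Fa; exists a, \bot%O; rewrite joinx0. Qed.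

Lemma filter_mod_compl F I a : is_filter F -> I a -> filter_mod F I (~` a)%O.
Proof. by move=> [F1 _ _] Ia; exists \top%O, a; rewrite joinCx. Qed.

(** If [\bot] were in [filter_mod F I], some [f] in [F] would lie below some [i]
    in [I], and [f] would be in both. *)
Lemma filter_mod_proper F I : is_filter F -> is_ideal I ->
  (forall a, F a -> ~ I a) -> proper_filter (filter_mod F I).
Proof.
move=> Ff Ii disj; have [F1 FI FU] := Ff; have [I0 IU ID] := Ii; split.
- exact: sub_filter_mod.
- move=> a b [f [i [Ff1 Ii1 fai]]] [f' [i' [Ff2 Ii2 fbi]]].
  exists (f `&` f')%O, (i `|` i')%O; split; [exact: FI|exact: IU|].
  rewrite joinIl lexI; apply/andP; split.
  + by apply: (le_trans (leIl _ _)); rewrite joinA (le_trans fai)// leUl.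
  + by apply: (le_trans (leIr _ _)); rewrite joinCA (le_trans fbi)// leUr.
- move=> a b ab [f [i [Ff1 Ii1 fai]]]; exists f, i; split=> //.
  by rewrite (le_trans fai)// leU2.
- move=> [f [i [Ff1 Ii1]]]; rewrite join0x => fi.
  exact: disj Ff1 (ID _ _ fi Ii1).
Qed.

(** The ultrafilter lemma. *)
Lemma proper_filter_extend F : proper_filter F ->
  exists x, F `<=` x.
Proof.
move=> Fp.
(* Parametrising the extensions of [F] by the sets added to it makes the empty
   chain harmless: its union is the empty set, which yields [F] itself. *)
have [C CP Ctot|G [GP Gmax]] :=
    @Zorn_bigcup A [set G | proper_filter (F `|` G)].
  have [F1 FI FU F0] := Fp.
  (* Two elements of the union already lie in a single proper extension. *)
  have two a b : (F `|` \bigcup_(X in C) X) a ->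
      (F `|` \bigcup_(X in C) X) b ->
      exists G, [/\ proper_filter (F `|` G), F `|` G `<=` F `|`
        \bigcup_(X in C) X, (F `|` G) a & (F `|` G) b].
    have up X : C X -> F `|` X `<=` F `|` \bigcup_(X in C) X.
      by move=> CX; apply: setUS; exact: bigcup_sup.
    move=> [Fa|[X CX Xa]] [Fb|[Y CY Yb]].
    - by exists set0; rewrite setU0; split=> // c; left.
    - by exists Y; split; [exact: CP|exact: up|left|right].
    - by exists X; split; [exact: CP|exact: up|right|left].
    - have [XY|YX] := Ctot _ _ CX CY.
      + by exists Y; split; [exact: CP|exact: up|right; exact: XY|right].
      + by exists X; split; [exact: CP|exact: up|right|right; exact: YX].
  split.
  - by left.
  - move=> a b Ha Hb; have [G [Gp GC Ga Gb]] := two _ _ Ha Hb.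
    by apply: GC; exact: (pf_meet Gp).
  - move=> a b ab Ha; have [G [Gp GC Ga _]] := two _ _ Ha Ha.
    by apply: GC; exact: (pf_up Gp ab).
  - by move=> H0; have [G [Gp _ G0 _]] := two _ _ H0 H0; exact: (pf_bot Gp).
have ultra : is_ultrafilter (F `|` G).
  split=> // H Hp FGH; apply/seteqP; split=> // a Ha.
  apply: contrapT => FGa; apply: (Gmax H).
    split; first by move=> b Gb; apply: FGH; right.
    by move=> /(_ _ Ha) Ga; apply: FGa; right.
  suff FH : F `|` H = H by rewrite /= FH.
  by apply/setUidPr => b Fb; apply: FGH; left.
by exists (MkUl ultra) => a Fa; left.
Qed.

(** The Boolean prime ideal theorem in its separation form: any ultrafilter
    above [filter_mod F I] contains the complements of the elements of [I],
    hence avoids [I]. *)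
Lemma ultrafilter_separation F I : is_filter F -> is_ideal I ->
  (forall a, F a -> ~ I a) ->
  exists x, F `<=` x /\ (forall a, I a -> ~ (x : set A) a).
Proof.
move=> Ff Ii disj.
have [x Fx] := proper_filter_extend (filter_mod_proper Ff Ii disj).
exists x; split; first by move=> a Fa; apply: Fx; exact: sub_filter_mod.
move=> a Ia xa; have [[_ xI _ x0] _] := ul_setP x; apply: x0.
by rewrite -(meetxC a); apply: xI => //; apply: Fx; exact: filter_mod_compl.
Qed.

(** By maximality [x] cannot be enlarged to [filter_mod x] of the principal
    ideal of [a], a proper filter that contains the complement of [a]. *)
Lemma ul_compl x a : (x : set A) (~` a)%O <-> ~ (x : set A) a.
Proof.
have xf := ul_filter x; have [xp xmax] := ul_setP x; have ai := principal_ideal a.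
split=> [xCa xa|xa].
  by apply: (pf_bot xp); rewrite -(meetxC a); exact: (pf_meet xp).
rewrite -(xmax (filter_mod x [set b | (b <= a)%O])).
- by apply: filter_mod_compl => /=.
- apply: filter_mod_proper => // b xb ba.
  by apply: xa; exact: ul_up xb.
- exact: sub_filter_mod.
Qed.

(** Compactness of [phi a]: a cover by the sets [phi i], with [i] in an
    ideal, has a member that alone covers. Take the principal filter of [a] in
    the separation lemma. *)
Lemma ideal_cover I a : is_ideal I ->
  (forall x, (x : set A) a -> exists2 i, I i & (x : set A) i) -> I a.
Proof.
move=> Ii cov; apply: contrapT => nIa; have [_ _ ID] := Ii.
have af : is_filter [set c | (a <= c)%O].
  split=> /= [|c e ac ae|c e ce ac]; first exact: lex1.
  - by rewrite lexI ac ae.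
  - exact: le_trans ce.
have [c ac Ic|x [ax xI]] := ultrafilter_separation af Ii.
  by apply: nIa; exact: ID ac Ic.
have [i Ii' xi] := cov x (ax a (lexx a)).
exact: xI Ii' xi.
Qed.

Lemma phi_sub a b : phi a `<=` phi b -> (a <= b)%O.
Proof.
move=> ab; apply: (@ideal_cover _ a (principal_ideal b)) => x /ab xb.
by exists b => //=.
Qed.

(** * Clopen sets and interiors *)

Lemma open_phi (U : set (Ul A)) x :
  open U -> U x -> exists2 a, (x : set A) a & phi a `<=` U.
Proof.
move=> [D DB <-] [B DB' xB]; have [a _ aB] := DB _ DB'.
rewrite -aB in xB; exists a => // y ya; exists B => //.
by rewrite -aB.
Qed.

Lemma phi_open a : open (phi a).
Proof.
exists [set phi a]; first by move=> _ ->; exists a.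
by rewrite bigcup_set1.
Qed.

Lemma phi_compl a : phi (~` a)%O = ~` phi a.
Proof. by apply/seteqP; split=> x /ul_compl. Qed.

Lemma phi_clopen a : clopen (phi a).
Proof.
split; first exact: phi_open.
by rewrite -openC -phi_compl; exact: phi_open.
Qed.

(** Compactness in lattice form: if the filter of the [a] with
    [U `<=` phi a] missed the ideal of the [a] with [phi a `<=` U], an
    ultrafilter separating them could lie neither in [U] nor outside [U],
    since both sets are open. *)
Lemma clopen_phi (U : set (Ul A)) : clopen U -> exists a, U = phi a.
Proof.
move=> [Uo Uc]; apply: contrapT => noU.
pose F := [set a | U `<=` phi a]; pose I := [set a | phi a `<=` U].
have Ff : is_filter F.
  split=> /= [x _|a b Ua Ub x Ux|a b ab Ua x Ux].
  - by have [] := ul_filter x.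
  - by have [_ xI _] := ul_filter x; apply: xI; [exact: Ua|exact: Ub].
  - by apply: ul_up ab _; exact: Ua.
have Ii : is_ideal I.
  split=> /= [x x0|a b aU bU x xab|a b ab bU x xa].
  - by have := pf_bot (ul_setP x).1.
  - have [xa|/ul_compl xCa] := pselect ((x : set A) a); first exact: aU.
    apply: bU; have [_ xI _] := ul_filter x.
    apply: ul_up (xI _ _ xab xCa).
    by rewrite meetUl meetxC join0x leIl.
  - by apply: bU; exact: ul_up xa.
have [a aF aI|x [xF xI]] := ultrafilter_separation Ff Ii.
  by apply: noU; exists a; apply/seteqP.
have [Ux|nUx] := pselect (U x).
  by have [a xa aU] := open_phi Uo Ux; exact: xI aU xa.
have [||a xa aU] := @open_phi (~` U) x => //; first by rewrite openC.
suff /xF/ul_compl : F (~` a)%O by [].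
by move=> y Uy; apply/ul_compl => /aU.
Qed.

End Separation.

Section Interior.
Context d (A : ctbDistrLatticeType d) (prec : S4_subordination A).

Lemma down_ideal (a : A) : is_ideal (Defs.down prec a).
Proof.
have [p0 _ _ pU pL] := S4_sub (prec_ofP prec); split=> [|b c|b c bc ca].
- exact: pL (lexx _) p0 (le0x _).
- exact: pU.
- exact: pL bc ca (lexx _).
Qed.

(** Where (S5) and (S6) enter. Reflexivity puts the basic open set of [b]
    inside [phi b]. Conversely, if the basic open set of [a] lies in [phi b]
    and [c] precedes [a], interpolate [e] between [c] and [a]: then [phi e]
    lies in [phi b], so [e <= b] and [c] precedes [b]. *)
Lemma intS_phi (b : A) : intS prec (phi b) = baseS prec b.
Proof.
have [sP p_le p_int] := prec_ofP prec.
apply/seteqP; split=> x.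
  rewrite /intS /interior /= nbhsE => -[B [[D DB <-] [E DE xE]] Bb].
  have [a _ aE] := DB _ DE.
  have {Bb}ab : baseS prec a `<=` (phi b : set (UlS prec)).
    by move=> y ya; apply: Bb; exists E => //; rewrite -aE.
  move: xE; rewrite -aE => -[c [xc ca]].
  have [e [ce ea]] := p_int _ _ ca.
  have eb : (e <= b)%O.
    by apply: phi_sub => y ye; apply: ab; exists e.
  by exists c; split=> //; exact: (sub_le sP) (lexx c) ce eb.
move=> xb; rewrite /intS /interior /= nbhsE.
exists (baseS prec b); last first.
  by move=> y [c [yc /p_le cb]]; exact: ul_up yc.
split=> //; exists [set baseS prec b]; first by move=> _ ->; exists b.
by rewrite bigcup_set1.
Qed.

End Interior.

(** * The dual relation on basic sets *)

Section DualRelation.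
Context d1 d2 (A1 : ctbDistrLatticeType d1) (A2 : ctbDistrLatticeType d2).
Context (h : A1 -> A2) (hh : is_meet_hom h).

Lemma meet_hom_homo (a b : A1) : (a <= b)%O -> (h a <= h b)%O.
Proof. by move=> /meet_idPl ab; rewrite -ab (hh.2 a b) leIr. Qed.

Lemma preimage_filter (x : Ul A2) : is_filter (h @^-1` x).
Proof.
have [x1 xI xU] := ul_filter x; split=> [|a b xa xb|a b ab]; rewrite /preimage/=.
- by rewrite hh.1.
- by rewrite hh.2; exact: xI.
- by apply: xU; exact: meet_hom_homo.
Qed.

(** Since [h] preserves finite meets, [h @^-1` x] is a filter, possibly
    improper; the ultrafilters above it are the points related to [x]. *)
Lemma dual_rel_avoid (x : Ul A2) (I : set A1) : is_ideal I ->
  (forall a, I a -> ~ (x : set A2) (h a)) ->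
  exists2 y, dual_rel h x y & forall a, I a -> ~ (y : set A1) a.
Proof.
move=> Ii xI; have [a xa /xI//|y [xy yI]] :=
  ultrafilter_separation (preimage_filter x) Ii.
by exists y.
Qed.

(** If [h b] is not in [x], the filter [h @^-1` x] misses [b] and extends to an
    ultrafilter that still misses [b]. *)
Lemma h_rel_phi (b : A1) : h_rel (dual_rel h) (phi b) = phi (h b).
Proof.
apply/seteqP; split=> x; last by move=> xb y; exact.
move=> Rb; apply: contrapT => xb.
have [a ab xa|y /Rb yb /(_ b (lexx b))] :=
  dual_rel_avoid (principal_ideal b) (x := x); last exact.
by apply: xb; apply: ul_up xa; exact: meet_hom_homo.
Qed.

(** The complement of [h_rel_phi], as [g_of h] is the conjugate of [h] under
    complementation. *)
Lemma g_rel_phi (a : A1) : g_rel (dual_rel h) (phi a) = phi (g_of h a).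
Proof.
apply: setC_inj; rewrite -phi_compl /g_of complK -h_rel_phi.
apply/seteqP; split=> [x nRa y Rxy|x Ra [y [/Ra yCa ya]]].
  by apply/ul_compl => ya; apply: nRa; exists y.
by move/ul_compl: yCa.
Qed.

End DualRelation.

(** * The three conditions in the dual spaces *)

Section Conditions.
Context d1 d2 (A1 : ctbDistrLatticeType d1) (A2 : ctbDistrLatticeType d2).
Context (prec1 : S4_subordination A1) (prec2 : S4_subordination A2).
Context (h : A1 -> A2) (hh : is_meet_hom h).

(** [R x] is empty exactly when the filter [h @^-1` x] is improper, that is,
    when [h \bot] lies in [x]. *)
Lemma cond_CO_dual : cond_CO h <-> forall x : Ul A2, dual_rel h x !=set0.
Proof.
split=> [h0 x|Rne].
  have [a a0 xa|y xy _] := dual_rel_avoid hh (principal_ideal \bot%O) (x := x).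
    apply: (pf_bot (ul_setP x).1); rewrite -h0.
    by apply: ul_up xa; exact: meet_hom_homo.
  by exists y.
apply/eqP; rewrite -lex0; apply: phi_sub => x xh0.
have [y xy] := Rne x.
by have /(pf_bot (ul_setP y).1) := xy _ xh0.
Qed.

(** For the converse, fix [a] preceding [h b]. The elements below some [h c]
    with [c] preceding [b] form an ideal, although [h] need not preserve
    joins, because [h c `|` h c' <= h (c `|` c')]. This ideal covers [phi a]:
    an ultrafilter containing [a] but missing it would be related to some
    ultrafilter outside the basic open set of [b]. *)
Lemma cond_QH_dual : cond_QH prec1 prec2 h <->
  forall b, baseS prec2 (h b) `<=` h_rel (dual_rel h) (baseS prec1 b).
Proof.
split=> [qh b x [a [xa /qh[c [ac cb]]]] y Rxy|sub a b ahb].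
  by exists c; split=> //; apply: Rxy; exact: ul_up xa.
have b_ideal := down_ideal prec1 b; have [I0 IU _] := b_ideal.
have Ji : is_ideal [set e : A2 | exists c, (e <= h c)%O /\ prec1 c b].
  split=> [|e e' [c [ec cb]] [c' [ec' cb']]|e e' ee' [c [ec cb]]].
  - by exists \bot%O; split; [exact: le0x|exact: I0].
  - exists (c `|` c')%O; split; last exact: IU.
    rewrite leUx (le_trans ec) ?(le_trans ec')//.
    + exact: (meet_hom_homo hh (leUr _ _)).
    + exact: (meet_hom_homo hh (leUl _ _)).
  - by exists c; split=> //; exact: le_trans ec.
apply: (ideal_cover Ji) => x xa; apply: contrapT => xJ.
have [c cb xhc|y Rxy yb] := dual_rel_avoid hh b_ideal (x := x).
  by apply: xJ; exists (h c) => //; exists c.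
have [|c [yc cb]] := sub b x _ y Rxy; first by exists a.
exact: yb cb yc.
Qed.

(** In the converse, the ideal of the elements that precede [h b] covers
    [phi (g_of h a)], which is the inverse image of [phi a] under the dual
    relation. *)
Lemma cond_DH_dual : cond_DH prec1 prec2 h <->
  forall b, g_rel (dual_rel h) (baseS prec1 b) `<=` baseS prec2 (h b).
Proof.
split=> [dh b x [y [Rxy [a [ya ab]]]]|sub a b ab].
  exists (g_of h a); split; last exact: dh.
  suff : phi (g_of h a) x by [].
  by rewrite -g_rel_phi//; exists y.
apply: (ideal_cover (down_ideal prec2 (h b))) => x xga.
have : phi (g_of h a) x by [].
rewrite -g_rel_phi// => -[y [Rxy ya]].
have [|c [xc cb]] := sub b x; last by exists c.
by exists y; split=> //; exists a.
Qed.

End Conditions.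

Theorem corollary38 (d1 d2 : Order.disp_t)
    (A1 : ctbDistrLatticeType d1) (A2 : ctbDistrLatticeType d2)
    (prec1 : S4_subordination A1) (prec2 : S4_subordination A2)
    (h : A1 -> A2) (hh : is_meet_hom h) :
  [/\ cond_CO h, cond_QH prec1 prec2 h & cond_DH prec1 prec2 h] <->
  (forall x : Ul A2, dual_rel h x !=set0) /\
  (forall U : set (Ul A1), clopen U ->
     g_rel (dual_rel h) (intS prec1 U) `<=` intS prec2 (h_rel (dual_rel h) U) /\
     intS prec2 (h_rel (dual_rel h) U) `<=` h_rel (dual_rel h) (intS prec1 U)).
Proof.
have intE U : clopen U -> exists b, [/\ U = phi b,
    intS prec1 U = baseS prec1 b &
    intS prec2 (h_rel (dual_rel h) U) = baseS prec2 (h b)].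
  move=> /clopen_phi[b ->]; exists b.
  by rewrite h_rel_phi// !intS_phi.
split=> [[/(cond_CO_dual hh) co /(cond_QH_dual _ _ hh) qh /(cond_DH_dual _ _ hh) dh]|[Rne sub]].
  by split=> // U /intE[b [_ -> ->]].
split; [exact/cond_CO_dual|apply/cond_QH_dual => // b|apply/cond_DH_dual => // b].
- have [_] := sub _ (phi_clopen b).
  by rewrite h_rel_phi// !intS_phi.
- have [+ _] := sub _ (phi_clopen b).
  by rewrite h_rel_phi// !intS_phi.
Qed.
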